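(* Let $R$ be an arbitrary (not necessarily commutative) ring with unity and let $P:R\to[0,1]$ be a non-constant fuzzy ideal of $R$. Then $P$ is semiprime if and only if $P$ is the intersection of a family of prime fuzzy ideals of $R$.
   Context: Let $R$ be a ring with unity. A (two-sided) fuzzy ideal of $R$ is a map $I:R\to[0,1]$ such that for all $x,y\in R$: $I(x-y)\ge\min\{I(x),I(y)\}$ and $I(xy)\ge\max\{I(x),I(y)\}$. The intersection of a family of fuzzy ideals is their pointwise infimum. A non-constant fuzzy ideal $P$ is prime if $\inf_{r\in R}P(xry)=\max\{P(x),P(y)\}$ for all $x,y\in R$. A non-constant fuzzy ideal $P$ is semiprime if $\inf_{r\in R}P(xrx)=P(x)$ for all $x\in R$. *)

(* Defs.v *)
From HB Require Import structures.
From mathcomp Require Import all_boot all_order all_algebra.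
From mathcomp Require Import all_classical reals.

Set Implicit Arguments.
Unset Strict Implicit.
Unset Printing Implicit Defensive.

Import Order.TTheory GRing.Theory Num.Theory.

Local Open Scope classical_set_scope.
Local Open Scope ring_scope.

Record fuzzy_ideal (K : realType) (R : pzRingType) (I : R -> K) : Prop := {
  fuzzy_ideal_unit_interval : forall x : R, 0 <= I x <= 1;
  fuzzy_ideal_sub : forall x y : R, Num.min (I x) (I y) <= I (x - y);
  fuzzy_ideal_mul : forall x y : R, Num.max (I x) (I y) <= I (x * y)
}.

Definition nonconstant (T U : Type) (f : T -> U) : Prop :=
  exists x y : T, f x <> f y.

Record prime_fuzzy_ideal (K : realType) (R : pzRingType) (P : R -> K) : Prop := {
  prime_fuzzy_ideal_ideal : fuzzy_ideal P;
  prime_fuzzy_ideal_nonconstant : nonconstant P;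
  prime_fuzzy_ideal_inf : forall x y : R,
    inf [set P (x * r * y) | r in [set: R]] = Num.max (P x) (P y)
}.

Record semiprime_fuzzy_ideal (K : realType) (R : pzRingType) (P : R -> K) : Prop := {
  semiprime_fuzzy_ideal_ideal : fuzzy_ideal P;
  semiprime_fuzzy_ideal_nonconstant : nonconstant P;
  semiprime_fuzzy_ideal_inf : forall x : R,
    inf [set P (x * r * x) | r in [set: R]] = P x
}.

(* Since [inf set0 = 0], the intersection of the empty family is the constant
   0 here and not the constant 1; in either convention it is constant, so it is
   never equal to a non-constant fuzzy ideal. *)
Definition fuzzy_intersection (K : realType) (R : pzRingType)
    (F : set (R -> K)) : R -> K :=
  fun x => inf [set Q x | Q in F].

(* Main.v *)
Require Import Defs.
From HB Require Import structures.
From mathcomp Require Import all_boot all_order all_algebra.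
From mathcomp Require Import all_classical reals.

(** A fuzzy ideal is governed by its level sets [P >= t], which are two-sided
    ideals, so the theorem reduces to the classical fact that every element
    outside a semiprime ideal is outside some prime ideal containing it.

    If [P] is semiprime and [P x < t <= P 0], the level set [P >= t] is a
    semiprime ideal that misses [x], hence there is a prime ideal [J] that
    contains it and misses [x] ([semiprime_avoidance]).  The two-valued map
    equal to [P 0] on [J] and to [t] off [J] is a prime fuzzy ideal when
    [0 <= t < P 0] ([two_valued_prime]); it lies above [P] and takes the value
    [t] at [x] ([prime_fuzzy_above]).  Letting [t] decrease to [P x], the prime
    fuzzy ideals [Q] with [P <= Q <= P 0] have pointwise infimum [P].  The upper
    bound has to be [P 0] and not [1]: since [P 0] may be less than [1], a
    larger top value would spoil the infimum at the points where [P] attains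
    its maximum [P 0].

    Conversely, semiprimeness of an infimum is inherited from the members:
    [inf_r P(xrx) <= inf_r Q(xrx) = Q x] for every member [Q], and the other
    inequality holds in every fuzzy ideal. *)

Set Implicit Arguments.
Unset Strict Implicit.
Unset Printing Implicit Defensive.

Import Order.TTheory GRing.Theory Num.Theory.

Local Open Scope classical_set_scope.
Local Open Scope ring_scope.

(** * Prime ideals of a noncommutative ring *)

Record ideal_set (R : pzRingType) (I : set R) : Prop := {
  ideal_set0 : I 0;
  ideal_set_sub : forall x y, I x -> I y -> I (x - y);
  ideal_set_mull : forall x y, I y -> I (x * y);
  ideal_set_mulr : forall x y, I x -> I (x * y)
}.

Definition m_system (R : pzRingType) (M : set R) : Prop :=
  forall x y, M x -> M y -> exists r, M (x * r * y).

Definition prime_set (R : pzRingType) (J : set R) : Prop :=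
  forall x y, ~ J x -> ~ J y -> exists r, ~ J (x * r * y).

Definition semiprime_set (R : pzRingType) (I : set R) : Prop :=
  forall x, ~ I x -> exists r, ~ I (x * r * x).

(** Colon ideals such as this one replace the ideals generated
    by [J] and one more element in the proof that maximal ideals avoiding an
    m-system are prime; no finite sums have to be handled. *)
Lemma ideal_set_colonl (R : pzRingType) (J : set R) (y : R) :
  ideal_set J -> ideal_set [set w | forall r, J (y * r * w)].
Proof.
case=> J0 JB Jl Jr; split => /=.
- by move=> r; rewrite mulr0.
- by move=> u v Ju Jv r; rewrite mulrBr; exact: JB.
- by move=> u v Jv r; rewrite mulrA -(mulrA y); exact: Jv.
- by move=> u v Ju r; rewrite mulrA; exact: Jr.
Qed.

Lemma ideal_set_colonr (R : pzRingType) (J : set R) (y : R) :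
  ideal_set J -> ideal_set [set w | forall r, J (w * r * y)].
Proof.
case=> J0 JB Jl Jr; split => /=.
- by move=> r; rewrite !mul0r.
- by move=> u v Ju Jv r; rewrite !mulrBl; exact: JB.
- by move=> u v Jv r; rewrite -!mulrA; apply: Jl; rewrite mulrA; exact: Jv.
- by move=> u v Ju r; rewrite -(mulrA u); exact: Ju.
Qed.

Lemma exists_maximal_avoiding (R : pzRingType) (I M : set R) :
  ideal_set I -> (forall x, I x -> ~ M x) ->
  exists J : set R, [/\ ideal_set J, I `<=` J, (forall x, J x -> ~ M x) &
    forall B, ideal_set B -> J `<` B -> exists2 x, B x & M x].
Proof.
move=> idI IM.
(* Zorn's lemma is applied to unions of arbitrary chains; letting the empty set
   count as a candidate takes care of the empty chain. *)
pose ok (X : set R) := X !=set0 ->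
  [/\ ideal_set X, I `<=` X & forall x, X x -> ~ M x].
have [C Cok Ctot|A [Aok Amax]] := @Zorn_bigcup R ok.
  move=> [w [X CX Xw]].
  have [idX IX XM] := Cok _ CX (ex_intro _ w Xw).
  have okC Y y : C Y -> Y y -> [/\ ideal_set Y, I `<=` Y & forall x, Y x -> ~ M x].
    by move=> CY Yy; apply: Cok CY _; exists y.
  split.
  - split.
    + by exists X => //; exact: (ideal_set0 idX).
    + move=> x y [Y CY Yx] [Z CZ Zy].
      have [[idY _ _] [idZ _ _]] := (okC _ _ CY Yx, okC _ _ CZ Zy).
      have [YZ|ZY] := Ctot _ _ CY CZ.
        by exists Z => //; apply: (ideal_set_sub idZ) => //; exact: YZ.
      by exists Y => //; apply: (ideal_set_sub idY) => //; exact: ZY.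
    + move=> x y [Y CY Yy]; have [idY _ _] := okC _ _ CY Yy.
      by exists Y => //; exact: (ideal_set_mull idY).
    + move=> x y [Y CY Yx]; have [idY _ _] := okC _ _ CY Yx.
      by exists Y => //; exact: (ideal_set_mulr idY).
  - by move=> x Ix; exists X => //; exact: IX.
  - by move=> x [Y CY Yx]; have [_ _ ] := okC _ _ CY Yx; apply.
have An0 : A !=set0.
  apply: contrapT => /set0P/negP; rewrite negbK => /eqP A0.
  apply: (Amax I); last by move=> _; split.
  by rewrite A0; split=> // /(_ _ (ideal_set0 idI)).
have [idA IA AM] := Aok An0.
exists A; split=> // B idB AB; apply: contrapT => nBM.
apply: (Amax B AB) => _; split => //.
- by apply: subset_trans IA _; exact: properW.
- by move=> x Bx Mx; apply: nBM; exists x.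
Qed.

(** An ideal [J] maximal among those that contain [I] and avoid the m-system is
    prime: if [y] and [z] are outside [J] but [y R z] is inside, then the
    elements [w] with [y R w] inside [J] form an ideal properly containing [J]
    (it has [z]), so it meets the m-system in some [n]; then the [w] with [w R n]
    inside [J] form another such ideal (it has [y]), with some [m] in common
    with the m-system.  Hence [m R n] is inside [J], against the m-system property. *)
Lemma exists_prime_avoiding (R : pzRingType) (I M : set R) :
  ideal_set I -> m_system M -> (forall x, I x -> ~ M x) ->
  exists J : set R, [/\ ideal_set J, prime_set J, I `<=` J &
    forall x, J x -> ~ M x].
Proof.
move=> idI sysM IM.
have [J [idJ IJ JM Jmax]] := exists_maximal_avoiding idI IM.
exists J; split=> // y z nJy nJz; apply: contrapT => nyz.
have yz r : J (y * r * z) by apply: contrapT => nJ; apply: nyz; exists r.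
have [n nB nM] : exists2 n, (forall r, J (y * r * n)) & M n.
  apply: (Jmax _ (ideal_set_colonl y idJ)); split.
    by move=> w Jw r; exact: (ideal_set_mull idJ).
  by move=> /(_ z yz).
have [m mB mM] : exists2 m, (forall r, J (m * r * n)) & M m.
  apply: (Jmax _ (ideal_set_colonr n idJ)); split.
    by move=> w Jw r; do 2!apply: (ideal_set_mulr idJ).
  by move=> /(_ y nB).
have [r Mr] := sysM _ _ mM nM.
exact: JM (mB r) Mr.
Qed.

(** Each term of [x_(n+1) = x_n * f x_n * x_n] is a left and a right multiple of
    all the earlier ones, so [x_(N+1)] with [N = max i j] is in [x_i R x_j]. *)
Lemma m_system_iter (R : pzRingType) (f : R -> R) (x : R) :
  m_system [set iter n (fun y => y * f y * y) x | n in [set: nat]].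
Proof.
set s := fun n => iter n _ x.
have sS n : s n.+1 = s n * f (s n) * s n by [].
have mult i k : (exists a, s (i + k)%N = s i * a) /\
                (exists b, s (i + k)%N = b * s i).
  elim: k => [|k [[a sa] [b sb]]].
    by rewrite addn0; split; exists 1; rewrite (mulr1, mul1r).
  rewrite addnS sS; split.
    by exists (a * f (s (i + k)%N) * s (i + k)%N); rewrite {1}sa !mulrA.
  by exists (s (i + k)%N * f (s (i + k)%N) * b); rewrite {3}sb !mulrA.
move=> _ _ [i _ <-] [j _ <-]; rewrite -/(s i) -/(s j).
have [[a sa] _] := mult i (maxn i j - i)%N.
have [_ [b sb]] := mult j (maxn i j - j)%N.
rewrite subnKC ?leq_maxl// in sa; rewrite subnKC ?leq_maxr// in sb.
exists (a * f (s (maxn i j)) * b), (maxn i j).+1 => //.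
by rewrite -/(s _) sS {1}sa {2}sb !mulrA.
Qed.

Lemma semiprime_avoidance (R : pzRingType) (I : set R) (x : R) :
  ideal_set I -> semiprime_set I -> ~ I x ->
  exists J : set R, [/\ ideal_set J, prime_set J, I `<=` J & ~ J x].
Proof.
move=> idI spI nIx.
have /choice[f fP] : forall y, exists r, ~ I y -> ~ I (y * r * y).
  move=> y; have [Iy|/spI[r Ir]] := pselect (I y); first by exists 0.
  by exists r.
have [|J [idJ prJ IJ JM]] := exists_prime_avoiding idI (@m_system_iter R f x).
  move=> y + [n _ yE]; rewrite -{}yE.
  by elim: n => [|n IH] //=; exact: fP.
by exists J; split=> // Jx; apply: (JM x Jx); exists 0%N.
Qed.

(** * Fuzzy ideals *)

Lemma inf_image_le (K : realType) (T : Type) (A : set T) (f : T -> K) (i : T) :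
  (forall j, A j -> 0 <= f j) -> A i -> inf [set f j | j in A] <= f i.
Proof.
move=> f0 Ai; apply: ge_inf; last by exists i.
by exists 0 => _ [j Aj <-]; exact: f0.
Qed.

Lemma le_inf_image (K : realType) (T : Type) (A : set T) (f : T -> K) (c : K) :
  A !=set0 -> (forall j, A j -> c <= f j) -> c <= inf [set f j | j in A].
Proof.
move=> [i Ai] cf; apply: lb_le_inf; first by exists (f i), i.
by move=> _ [j Aj <-]; exact: cf.
Qed.

Section fuzzy_ideal_theory.
Context {K : realType} {R : pzRingType} {P : R -> K}.
Hypothesis fP : fuzzy_ideal P.

Lemma fuzzy_ideal_ge0 x : 0 <= P x.
Proof. by have /andP[] := fuzzy_ideal_unit_interval fP x. Qed.

Lemma fuzzy_ideal_le_mull x y : P y <= P (x * y).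
Proof. by apply: le_trans (fuzzy_ideal_mul fP x y); rewrite le_max lexx orbT. Qed.

Lemma fuzzy_ideal_le_mulr x y : P x <= P (x * y).
Proof. by apply: le_trans (fuzzy_ideal_mul fP x y); rewrite le_max lexx. Qed.

Lemma fuzzy_ideal_le0 x : P x <= P 0.
Proof. by rewrite -(mulr0 x); exact: fuzzy_ideal_le_mulr. Qed.

Lemma fuzzy_ideal_lt0 : nonconstant P -> exists x, P x < P 0.
Proof.
move=> [x [y xy]]; apply: contrapT => nlt; apply: xy.
have top z : P z = P 0.
  apply/eqP; rewrite eq_le fuzzy_ideal_le0 leNgt; apply/negP => ltz.
  by apply: nlt; exists z.
by rewrite !top.
Qed.

Lemma ideal_set_level t : t <= P 0 -> ideal_set [set x | t <= P x].
Proof.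
move=> t0; split => //= x y.
- move=> tx ty; apply: le_trans (fuzzy_ideal_sub fP x y).
  by rewrite le_min tx ty.
- by move=> /le_trans; apply; exact: fuzzy_ideal_le_mull.
- by move=> /le_trans; apply; exact: fuzzy_ideal_le_mulr.
Qed.

End fuzzy_ideal_theory.

Lemma semiprime_set_level (K : realType) (R : pzRingType) (P : R -> K) (t : K) :
  semiprime_fuzzy_ideal P -> semiprime_set [set x | t <= P x].
Proof.
move=> [fP _ spP] x /= ntx; apply: contrapT => nr; apply: ntx.
rewrite -spP; apply: le_inf_image; first by exists 0.
by move=> r _; apply: contrapT => ntr; apply: nr; exists r.
Qed.

Definition two_valued (K : realType) (R : pzRingType) (J : set R) (c t : K) :
  R -> K := fun x => if x \in J then c else t.

Section two_valued_theory.
Context {K : realType} {R : pzRingType} {J : set R} {c t : K}.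

Lemma two_valued_in x : J x -> two_valued J c t x = c.
Proof. by rewrite /two_valued => /mem_set ->. Qed.

Lemma two_valued_notin x : ~ J x -> two_valued J c t x = t.
Proof. by move=> nJx; rewrite /two_valued memNset. Qed.

Hypotheses (idJ : ideal_set J) (t0 : 0 <= t) (tc : t < c) (c1 : c <= 1).

Let two_valued_bounds x : t <= two_valued J c t x <= c.
Proof. by rewrite /two_valued; case: ifP => _; rewrite lexx (ltW tc). Qed.

Lemma two_valued_fuzzy_ideal : fuzzy_ideal (two_valued J c t).
Proof.
have up x : two_valued J c t x <= c by have /andP[] := two_valued_bounds x.
have lo x : t <= two_valued J c t x by have /andP[] := two_valued_bounds x.
split.
- by move=> x; rewrite (le_trans t0 (lo x)) (le_trans (up x) c1).
- move=> x y; rewrite ge_min.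
  have [Jx|/two_valued_notin ->] := pselect (J x); last by rewrite lo.
  have [Jy|/two_valued_notin ->] := pselect (J y); last by rewrite lo orbT.
  by rewrite (two_valued_in (ideal_set_sub idJ Jx Jy)) up.
- move=> x y; rewrite ge_max; apply/andP; split.
    have [Jx|/two_valued_notin ->//] := pselect (J x).
    by rewrite (two_valued_in (ideal_set_mulr idJ y Jx)).
  have [Jy|/two_valued_notin ->//] := pselect (J y).
  by rewrite (two_valued_in (ideal_set_mull idJ x Jy)).
Qed.

Lemma two_valued_prime : prime_set J -> J != setT ->
  prime_fuzzy_ideal (two_valued J c t).
Proof.
move=> prJ /eqP JT; split; first exact: two_valued_fuzzy_ideal.
  have [x nJx] : exists x, ~ J x by apply/existsNP => JA; apply: JT; rewrite -subTset.
  exists 0, x; rewrite (two_valued_in (ideal_set0 idJ)) (two_valued_notin nJx).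
  by move/eqP; rewrite gt_eqF.
have fQ := two_valued_fuzzy_ideal.
move=> x y; apply/eqP; rewrite eq_le; apply/andP; split; last first.
  apply: le_inf_image; first by exists 0.
  move=> r _; rewrite ge_max (fuzzy_ideal_le_mull fQ) andbT.
  by rewrite -mulrA (fuzzy_ideal_le_mulr fQ).
have Qinf r : inf [set two_valued J c t (x * s * y) | s in [set: R]] <=
              two_valued J c t (x * r * y).
  apply: (@inf_image_le K R setT (fun s => two_valued J c t (x * s * y))) => //.
  by move=> s _; exact: (fuzzy_ideal_ge0 fQ).
have Qc : inf [set two_valued J c t (x * s * y) | s in [set: R]] <= c.
  by apply: le_trans (Qinf 0) _; have /andP[] := two_valued_bounds (x * 0 * y).
rewrite le_max.
have [Jx|nJx] := pselect (J x); first by rewrite (two_valued_in Jx) Qc.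
have [Jy|nJy] := pselect (J y); first by rewrite (two_valued_in Jy) Qc orbT.
have [r nJr] := prJ _ _ nJx nJy.
by have := Qinf r; rewrite (two_valued_notin nJx) (two_valued_notin nJr) => ->.
Qed.

End two_valued_theory.

(** * Semiprime fuzzy ideals as intersections of primes *)

Lemma prime_fuzzy_above (K : realType) (R : pzRingType) (P : R -> K) (x : R) (t : K) :
  semiprime_fuzzy_ideal P -> P x < t -> t < P 0 ->
  exists Q : R -> K, [/\ prime_fuzzy_ideal Q,
    (forall y, P y <= Q y), (forall y, Q y <= P 0) & Q x = t].
Proof.
move=> spP xt tP0; have fP := semiprime_fuzzy_ideal_ideal spP.
have [|J [idJ prJ PJ nJx]] := semiprime_avoidance
    (ideal_set_level fP (ltW tP0)) (semiprime_set_level (t := t) spP) (x := x).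
  by move=> /=; rewrite leNgt xt.
exists (two_valued J (P 0) t); split.
- apply: two_valued_prime => //.
  + exact: le_trans (fuzzy_ideal_ge0 fP x) (ltW xt).
  + by have /andP[] := fuzzy_ideal_unit_interval fP 0.
  + by apply/eqP => JT; apply: nJx; rewrite JT.
- move=> y; have [Jy|nJy] := pselect (J y).
    by rewrite two_valued_in// fuzzy_ideal_le0.
  rewrite two_valued_notin// leNgt; apply/negP => ty; apply: nJy.
  exact: PJ (ltW ty).
- by move=> y; rewrite /two_valued; case: ifP => // _; exact: ltW.
- exact: two_valued_notin.
Qed.

Lemma semiprime_fuzzy_intersection (K : realType) (R : pzRingType) (P : R -> K) :
  semiprime_fuzzy_ideal P ->
  P = fuzzy_intersection [set Q | [/\ prime_fuzzy_ideal Q,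
    (forall y, P y <= Q y) & (forall y, Q y <= P 0)]].
Proof.
move=> spP; have [fP ncP _] := spP; set F := [set Q | _].
have Finf (Q : R -> K) z : F Q -> fuzzy_intersection F z <= Q z.
  move=> FQ; apply: (@inf_image_le K (R -> K) F (fun S => S z)) => //.
  by move=> S [[fS _ _] _ _]; exact: (fuzzy_ideal_ge0 fS).
have above z t : P z < t -> t < P 0 -> exists2 Q, F Q & Q z = t.
  by move=> zt t0; have [Q [? ? ? ?]] := prime_fuzzy_above spP zt t0; exists Q.
have [Q0 FQ0] : F !=set0.
  have [z z0] := fuzzy_ideal_lt0 fP ncP.
  have [Q FQ _] := above _ _ (midf_lt z0).1 (midf_lt z0).2.
  by exists Q.
apply/funext => x; apply/eqP; rewrite eq_le; apply/andP; split.
  by apply: le_inf_image; [exists Q0 | move=> Q [_ PQ _]; exact: PQ].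
have [xlt0|P0x] := ltP (P x) (P 0); last first.
  by apply: le_trans P0x; apply: le_trans (Finf _ x FQ0) _; have [_ _] := FQ0; apply.
rewrite leNgt; apply/negP => xltF.
(* A value of [t] below both the supposed gap and [P 0] gives a member of the
   family that is smaller at [x] than the infimum. *)
have xm : P x < Num.min (fuzzy_intersection F x) (P 0) by rewrite lt_min xltF xlt0.
have [xt] := midf_lt xm; set t := (_ / _) in xt *; rewrite lt_min => /andP[tF t0].
have [Q FQ Qx] := above _ _ xt t0.
by have := Finf _ x FQ; rewrite Qx leNgt tF.
Qed.

Lemma fuzzy_intersection_semiprime (K : realType) (R : pzRingType)
    (F : set (R -> K)) :
  fuzzy_ideal (fuzzy_intersection F) -> nonconstant (fuzzy_intersection F) ->
  (forall Q, F Q -> prime_fuzzy_ideal Q) ->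
  semiprime_fuzzy_ideal (fuzzy_intersection F).
Proof.
move=> fP ncP FP; split=> // x.
have F0 : F !=set0.
  apply: contrapT => /set0P/negP; rewrite negbK => /eqP FE.
  by have [u [v]] := ncP; rewrite /fuzzy_intersection FE !image_set0.
apply/eqP; rewrite eq_le; apply/andP; split; last first.
  apply: le_inf_image; first by exists 0.
  by move=> r _; exact: (fuzzy_ideal_le_mull fP).
apply: le_inf_image => // Q FQ; have [fQ _ prQ] := FP Q FQ.
rewrite -[leRHS]maxxx -prQ; apply: le_inf_image; first by exists 0.
move=> r _; apply: le_trans
  (@inf_image_le K (R -> K) F (fun S => S (x * r * x)) Q _ FQ).
  apply: (@inf_image_le K R setT (fun s => fuzzy_intersection F (x * s * x))) => //.
  by move=> s _; exact: (fuzzy_ideal_ge0 fP).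
by move=> S /FP[fS _ _]; exact: (fuzzy_ideal_ge0 fS).
Qed.

Theorem theorem5p5 (K : realType) (R : pzRingType) (P : R -> K)
    (fuzzyP : fuzzy_ideal P) (nonconstP : nonconstant P) :
  semiprime_fuzzy_ideal P <->
  exists F : set (R -> K),
    (forall Q : R -> K, F Q -> prime_fuzzy_ideal Q) /\
    P = fuzzy_intersection F.
Proof.
split=> [spP|[F [FP PE]]].
  by eexists; split; last exact: (semiprime_fuzzy_intersection spP); move=> Q [].
by rewrite PE in fuzzyP nonconstP *; exact: fuzzy_intersection_semiprime.
Qed.
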